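(* If MAPTree is run without a time budget (so that its main loop exits only when $LB[r]\ge UB[r]$), its output is a minimum-cost solution graph of $\mathcal G_{\mathcal X,\mathcal Y}$.
   Context: Let $x_1,\dots,x_N\in\{0,1\}^F$ be a binary dataset $\mathcal X$ with labels $\mathcal Y\in\{0,1\}^N$, $[N]=\{1,\dots,N\}$. For $\mathcal I\subseteq[N]$, $f\in[F]$, $k\in\{0,1\}$ let $\mathcal I|_{f=k}=\{i\in\mathcal I:(x_i)_f=k\}$, $c^k(\mathcal I)=|\{i\in\mathcal I:y_i=k\}|$, $\mathcal V(\mathcal I)=\{f:\mathcal I|_{f=0}\neq\emptyset\text{ and }\mathcal I|_{f=1}\neq\emptyset\}$. Fix $\rho^1,\rho^0>0$, $\alpha\in(0,1)$, $\beta\ge0$; $\ell_{\rm leaf}(c^1,c^0)=B(c^1+\rho^1,c^0+\rho^0)/B(\rho^1,\rho^0)$ ($B$ the Beta function), $p_{\rm split}(d)=\alpha(1+d)^{-\beta}$, $p_{\rm leaf}(d,\mathcal I)=1$ if $\mathcal V(\mathcal I)=\emptyset$ else $1-p_{\rm split}(d)$, $p_{\rm inner}(d,\mathcal I)=0$ if $\mathcal V(\mathcal I)=\emptyset$ else $p_{\rm split}(d)/|\mathcal V(\mathcal I)|$; $-\log0=+\infty$, and a minimum over an empty set is $+\infty$. Graph $\mathcal G=\mathcal G_{\mathcal X,\mathcal Y}$: for nonempty $\mathcal I\subseteq[N]$, $d\in\{0,\dots,F\}$, an OR node $o_{\mathcal I,d}$ with terminal child $t_{\mathcal I,d}$ (edge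 cost $-\log p_{\rm leaf}(d,\mathcal I)-\log\ell_{\rm leaf}(c^1(\mathcal I),c^0(\mathcal I))$); for $d<F$, $f\in\mathcal V(\mathcal I)$, an AND child $a_{\mathcal I,d,f}$ (edge cost $-\log p_{\rm inner}(d,\mathcal I)$) with cost-$0$ edges to $o_{\mathcal I|_{f=0},d+1}$, $o_{\mathcal I|_{f=1},d+1}$; root $r=o_{[N],0}$; only nodes reachable from $r$ kept. A solution graph is a node set $\mathcal S\ni r$, all of whose nodes are reachable from $r$ inside $\mathcal S$, with every AND node of $\mathcal S$ having both children in $\mathcal S$ and every OR node of $\mathcal S$ exactly one child in $\mathcal S$; its cost is the sum of costs of edges $u\to v$ with $u,v\in\mathcal S$. Heuristic: $h(o_{\mathcal I,d})=-\max\{\log\ell_{\rm leaf}(c^1(\mathcal I),c^0(\mathcal I)),\log p_{\rm split}(d)+\log\ell_{\rm leaf}(c^1(\mathcal I),0)+\log\ell_{\rm leaf}(0,c^0(\mathcal I))\}$. MAPTree maintains a node set $\mathcal G'$, a set $\mathcal E$ of expanded OR nodes, and values $LB[u],UB[u]\in\mathbb R\cup\{+\infty\}$ for OR nodes ($UB[u]=+\infty$ until set); for an AND node $a$ with children $o_0,o_1$, $LB[a]=LB[o_0]+LB[o_1]$ and $UB[a]=UB[o_0]+UB[o_1]$. Initialize $\mathcal G'=\{r\}$, $\mathcal E=\emptyset$, $LB[r]=h(r)$, $UB[r]=+\infty$. While $LB[r]<UB[r]$ (and optionally while time remains): (1) $o:=r$; while $o\in\mathcal E$, choose an AND child $a^*$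 of $o$ minimizing $\mathrm{cost}(o,a)+LB[a]$, with children $o_0$ (value-0 side) and $o_1$, and set $o:=o_0$ if $UB[o_0]-LB[o_0]>UB[o_1]-LB[o_1]$, else $o:=o_1$. (2) Add $o$ to $\mathcal E$ and its terminal child to $\mathcal G'$; for each AND child $a$ of $o$ with children $o_0,o_1$, add $a,o_0,o_1$ to $\mathcal G'$ and set $LB[o_0]:=h(o_0)$, $LB[o_1]:=h(o_1)$. (3) Starting from $Q=\{o\}$, repeatedly remove from $Q$ an OR node $u$ of maximal depth, compute $v=\min\{\min_a(\mathrm{cost}(u,a)+LB[a]),\mathrm{cost}(u,t_u)\}$ over the AND children $a$ and terminal child $t_u$ of $u$; if $v>LB[u]$, set $LB[u]:=v$ and add to $Q$ every OR node of $\mathcal G'$ that is the parent of an AND node of $\mathcal G'$ having $u$ as child. (4) The same with $UB$ in place of $LB$, updating when $v<UB[u]$. Output $\mathrm{getSolution}(r)$, where for an OR node $u$ with terminal child $t$: if $u$ has no AND child or $\mathrm{cost}(u,t)\le\min_a(\mathrm{cost}(u,a)+UB[a])$, return $\{u,t\}$; else, with $a^*$ attaining the minimum and children $u_0,u_1$, return $\{u,a^*\}\cup\mathrm{getSolution}(u_0)\cup\mathrm{getSolution}(u_1)$. *)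

(* Defs.v *)
From HB Require Import structures.
From mathcomp Require Import all_boot all_order all_algebra.
From mathcomp Require Import all_classical all_reals all_analysis.
Set Implicit Arguments. Unset Strict Implicit. Unset Printing Implicit Defensive.
Import Order.TTheory GRing.Theory Num.Theory.
Local Open Scope ring_scope.

Definition Beta {R : realType} (a b : R) : R :=
  fine (\int[@lebesgue_measure R]_(t in `[0%R, 1%R])
          ((t `^ (a - 1)) * ((1 - t) `^ (b - 1)))%:E)%E.

Definition nlog {R : realType} (p : R) : \bar R :=
  if p == 0 then +oo%E else (- ln p)%:E.

Section MAPTree.
Context {R : realType}.
Variables (N F : nat) (X : 'I_N -> 'I_F -> bool) (Y : 'I_N -> bool).
Variables (rho1 rho0 alpha beta : R).

Definition restr (I : {set 'I_N}) (f : 'I_F) (k : bool) : {set 'I_N} :=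
  [set i in I | X i f == k].
Definition cnt (k : bool) (I : {set 'I_N}) : nat := #|[set i in I | Y i == k]|.
Definition Vset (I : {set 'I_N}) : {set 'I_F} :=
  [set f | (restr I f false != finset.set0) && (restr I f true != finset.set0)].

Definition lleaf (c1 c0 : nat) : R :=
  Beta (c1%:R + rho1) (c0%:R + rho0) / Beta rho1 rho0.
Definition psplit (d : nat) : R := alpha * (1 + d%:R) `^ (- beta).
Definition pleaf (d : nat) (I : {set 'I_N}) : R :=
  if Vset I == finset.set0 then 1 else 1 - psplit d.
Definition pinner (d : nat) (I : {set 'I_N}) : R :=
  if Vset I == finset.set0 then 0 else psplit d / #|Vset I|%:R.

Definition hval (I : {set 'I_N}) (d : nat) : \bar R :=
  (- Num.max (ln (lleaf (cnt true I) (cnt false I)))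
             (ln (psplit d) + ln (lleaf (cnt true I) 0) + ln (lleaf 0 (cnt false I))))%:E.

Definition node : finType :=
  (({set 'I_N} * 'I_F.+1) + ({set 'I_N} * 'I_F.+1) + ({set 'I_N} * 'I_F.+1 * 'I_F))%type.

Definition ORn (I : {set 'I_N}) (d : 'I_F.+1) : node := inl (inl (I, d)).
Definition TERMn (I : {set 'I_N}) (d : 'I_F.+1) : node := inl (inr (I, d)).
Definition ANDn (I : {set 'I_N}) (d : 'I_F.+1) (f : 'I_F) : node := inr (I, d, f).

Definition isOR (u : node) : bool := if u is inl (inl _) then true else false.
Definition isAND (u : node) : bool := if u is inr _ then true else false.

Definition depth (u : node) : nat :=
  match u with
  | inl (inl (_, d)) => val d
  | inl (inr (_, d)) => val d
  | inr (_, d, _) => val d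
  end.

(* edges of G (before restricting to nodes reachable from the groot) *)
Definition edge (u v : node) : bool :=
  match u, v with
  | inl (inl (s1, d)), inl (inr (s2, e)) => [&& s1 != finset.set0, s2 == s1 & e == d]
  | inl (inl (s1, d)), inr (s2, e, f) =>
      [&& s1 != finset.set0, s2 == s1, e == d, (val d < F)%N & f \in Vset s1]
  | inr (s1, d, f), inl (inl (s2, e)) =>
      [&& s1 != finset.set0, (val d < F)%N, f \in Vset s1, val e == (val d).+1 &
          (s2 == restr s1 f false) || (s2 == restr s1 f true)]
  | _, _ => false
  end.

Definition cost (u v : node) : \bar R :=
  match u, v with
  | inl (inl (s1, d)), inl (inr _) =>
      (nlog (pleaf (val d) s1) + nlog (lleaf (cnt true s1) (cnt false s1)))%E
  | inl (inl (s1, d)), inr _ => nlog (pinner (val d) s1)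
  | _, _ => 0%E
  end.

Definition groot : node := ORn [set: 'I_N] ord0.

Definition inG (u : node) : bool := connect edge groot u.

Definition solution_graph (S : {set node}) : Prop :=
  [/\ groot \in S,
      {in S, forall u, inG u},
      {in S, forall u, connect [rel x y | [&& x \in S, y \in S & edge x y]] groot u},
      {in S, forall a, isAND a -> forall v, inG v -> edge a v -> v \in S} &
      {in S, forall u, isOR u -> #|[set v in S | inG v && edge u v]| = 1%N}].

Definition sgcost (S : {set node}) : \bar R :=
  (\sum_(u in S) \sum_(v in S | edge u v) cost u v)%E.

Definition hnode (u : node) : \bar R :=
  match u with inl (inl (s1, d)) => hval s1 (val d) | _ => 0%E end.

Definition kid (k : bool) (a : node) : node :=
  match a with
  | inr (s1, d, f) => ORn (restr s1 f k) (inord (val d).+1)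
  | _ => a
  end.
Definition term (u : node) : node :=
  match u with inl (inl (s1, d)) => TERMn s1 d | _ => u end.

Record state := St {
  Gp : {set node};
  Ex : {set node};
  LB : node -> \bar R;
  UB : node -> \bar R }.

Definition valA (B : node -> \bar R) (a : node) : \bar R :=
  (B (kid false a) + B (kid true a))%E.

Definition andkids (G' : {set node}) (u : node) : {set node} :=
  [set a in G' | isAND a && edge u a].

Definition minA (G' : {set node}) (B : node -> \bar R) (u : node) : \bar R :=
  (\big[Order.min/+oo]_(a in andkids G' u) (cost u a + valA B a))%E.

Definition newval (G' : {set node}) (B : node -> \bar R) (u : node) : \bar R :=
  Order.min (minA G' B u) (cost u (term u)).

Definition parents (G' : {set node}) (u : node) : {set node} :=
  [set p in G' | isOR p && [exists a in G', isAND a && edge p a && edge a u]].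

Definition upd (B : node -> \bar R) (u : node) (v : \bar R) : node -> \bar R :=
  fun w => if w == u then v else B w.

(* step (1): descent from the groot to a non-expanded OR node
   (any tie-breaking among minimizing AND children) *)
Inductive descend (st : state) : node -> node -> Prop :=
| desc_stop o : o \notin Ex st -> descend st o o
| desc_step o a o'' :
    o \in Ex st -> a \in andkids (Gp st) o ->
    (forall a', a' \in andkids (Gp st) o ->
       (cost o a + valA (LB st) a <= cost o a' + valA (LB st) a')%E) ->
    descend st
      (if (UB st (kid true a) - LB st (kid true a) <
           UB st (kid false a) - LB st (kid false a))%E
       then kid false a else kid true a) o'' ->
    descend st o o''.

Definition expand (st : state) (o : node) : state :=
  let kids := [set a | isAND a && edge o a] in
  St (Gp st :|: [set term o] :|: kids :|: [set kid false a | a in kids]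
             :|: [set kid true a | a in kids])
     (o |: Ex st)
     (fun v => if [exists a in kids, (v == kid false a) || (v == kid true a)]
               then hnode v else LB st v)
     (UB st).

Inductive propagate (G' : {set node}) (better : \bar R -> \bar R -> bool) :
    {set node} -> (node -> \bar R) -> (node -> \bar R) -> Prop :=
| prop_done B : propagate G' better finset.set0 B B
| prop_step (Q : {set node}) (B B' : node -> \bar R) (u : node) :
    u \in Q -> (forall w, w \in Q -> depth w <= depth u)%N ->
    propagate G' better
      (if better (newval G' B u) (B u) then (Q :\ u) :|: parents G' u else Q :\ u)
      (if better (newval G' B u) (B u) then upd B u (newval G' B u) else B) B' ->
    propagate G' better Q B B'.

Definition lb_better (v old : \bar R) : bool := (old < v)%E.
Definition ub_better (v old : \bar R) : bool := (v < old)%E.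

Inductive iteration (st st' : state) : Prop :=
| iter_step o LB' UB' :
    (LB st groot < UB st groot)%E ->
    descend st groot o ->
    propagate (Gp (expand st o)) lb_better [set o] (LB (expand st o)) LB' ->
    propagate (Gp (expand st o)) ub_better [set o] (UB (expand st o)) UB' ->
    st' = St (Gp (expand st o)) (Ex (expand st o)) LB' UB' ->
    iteration st st'.

Definition init : state := St [set groot] finset.set0 hnode (fun _ => +oo%E).

Inductive reachable_state : state -> Prop :=
| rs_init : reachable_state init
| rs_iter st st' : reachable_state st -> iteration st st' -> reachable_state st'.

(* getSolution: [ch u] is the tie-breaking choice of a minimizing AND child *)
Definition valid_choice (st : state) (ch : node -> node) : Prop :=
  forall u, andkids (Gp st) u != finset.set0 ->
    ch u \in andkids (Gp st) u /\
    (cost u (ch u) + valA (UB st) (ch u) = minA (Gp st) (UB st) u)%E.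

Definition decision (st : state) (ch : node -> node) (u : node) : node :=
  if (andkids (Gp st) u == finset.set0) || (cost u (term u) <= minA (Gp st) (UB st) u)%E
  then term u else ch u.

Definition solrel (st : state) (ch : node -> node) : rel node :=
  fun u v => if isOR u then v == decision st ch u else isAND u && edge u v.

Definition getSolution (st : state) (ch : node -> node) : {set node} :=
  [set v | connect (solrel st ch) groot v].

End MAPTree.

(* Main.v *)
Require Import Defs.
From HB Require Import structures.
From mathcomp Require Import all_boot all_order all_algebra.
From mathcomp Require Import all_classical all_reals all_analysis.
From mathcomp Require Import measurable_realfun ring lra.
Set Implicit Arguments. Unset Strict Implicit. Unset Printing Implicit Defensive.
Import Order.TTheory GRing.Theory Num.Theory.
Local Open Scope ring_scope.

(* The heuristic is consistent: [lleaf] is the mixed moment E[p^a (1-p)^b] of a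
   Beta variable, and Chebyshev's association inequality makes E[p^a] and
   E[(1-p)^b] supermultiplicative and bounds the mixed moment by their product.
   Hence [LB <= opt] is preserved by the search (including when an expansion
   resets a shared node to [hnode]), while each [UB u] dominates the value of the
   decision taken at [u]. Below an AND node the two branches carry disjoint
   index sets, so a solution graph is a tree and its cost is additive; at
   termination cost(getSolution) <= UB r <= LB r <= opt r <= cost(S). *)

(** * Association inequalities for Beta moments *)

Lemma expr_comonotone (R : realDomainType) (s t : R) (a b : nat) :
  0 <= s -> 0 <= t -> 0 <= (t ^+ a - s ^+ a) * (t ^+ b - s ^+ b).
Proof.
move=> s0 t0; case: (leP s t) => [st|/ltW ts].
  by apply: mulr_ge0; rewrite subr_ge0 lerXn2r // nnegrE.
by apply: mulr_le0; rewrite subr_le0 lerXn2r // nnegrE.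
Qed.

Lemma expr_onem_antimonotone (R : realDomainType) (s t : R) (a b : nat) :
  0 <= s <= 1 -> 0 <= t <= 1 ->
  (t ^+ a - s ^+ a) * ((1 - t) ^+ b - (1 - s) ^+ b) <= 0.
Proof.
move=> /andP[s0 s1] /andP[t0 t1]; case: (leP s t) => [st|/ltW ts].
  apply: mulr_ge0_le0; rewrite ?subr_ge0 ?subr_le0 lerXn2r ?nnegrE ?subr_ge0 //.
  by rewrite lerD2l lerN2.
apply: mulr_le0_ge0; rewrite ?subr_ge0 ?subr_le0 lerXn2r ?nnegrE ?subr_ge0 //.
by rewrite lerD2l lerN2.
Qed.

(** The mean of [t ^+ a] under a weight on [0, 1] is itself a value [s ^+ a]. This [s] is the point
    where [t ^+ a] crosses its mean, which fixes the sign of the Chebyshev integrand pointwise and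
    avoids a double integral. *)
Lemma expr_root01 (R : realType) (a : nat) (m : R) :
  (0 < a)%N -> 0 <= m <= 1 -> exists2 s, 0 <= s <= 1 & s ^+ a = m.
Proof.
move=> a0 /andP[m0 m1]; exists (m `^ (a%:R^-1)); last first.
  by rewrite -powR_mulrn ?powR_ge0 // -powRrM mulVf ?powRr1 // pnatr_eq0 -lt0n.
rewrite powR_ge0 /=.
have := @ge0_ler_powR R a%:R^-1 _ m 1; rewrite powR1; by apply; rewrite ?nnegrE ?invr_ge0.
Qed.

Section Chebyshev.
Context d (T : measurableType d) (R : realType).
Variable mu : {measure set T -> \bar R}.

(* With [m] the [w]-mean of [f], integrate [(f - m) * (g - q) * w >= 0]. *)
Lemma chebyshev_association (D : set T) (w f g : T -> R) (m q : R) :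
  measurable D ->
  mu.-integrable D (EFin \o w) ->
  mu.-integrable D (EFin \o (fun t => f t * w t)) ->
  mu.-integrable D (EFin \o (fun t => g t * w t)) ->
  mu.-integrable D (EFin \o (fun t => f t * g t * w t)) ->
  (forall t, D t -> 0 <= w t) ->
  (forall t, D t -> 0 <= (f t - m) * (g t - q)) ->
  m * \int[mu]_(t in D) w t = \int[mu]_(t in D) (f t * w t) ->
  m * \int[mu]_(t in D) (g t * w t) <= \int[mu]_(t in D) (f t * g t * w t).
Proof.
move=> mD iw ifw igw ifgw w0 fg0 mE.
have iZ (r : R) (h : T -> R) : mu.-integrable D (EFin \o h) ->
    mu.-integrable D (EFin \o (fun t => r * h t)).
  by move=> ih; apply: eq_integrable (integrableZl mD r ih).
have iB (h k : T -> R) : mu.-integrable D (EFin \o h) ->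
    mu.-integrable D (EFin \o k) ->
    mu.-integrable D (EFin \o (fun t => h t - k t)).
  by move=> ih ik; apply: eq_integrable (integrableB mD ih ik).
(* The terms are grouped so that [q] multiplies the integral of [f * w - m * w], which vanishes
   because [m] is the mean. *)
have : 0 <= \int[mu]_(t in D)
    ((f t * g t * w t - m * (g t * w t)) - q * (f t * w t - m * w t)).
  apply: Rintegral_ge0 => t Dt.
  suff -> : (f t * g t * w t - m * (g t * w t)) - q * (f t * w t - m * w t)
    = (f t - m) * (g t - q) * w t by rewrite mulr_ge0 ?fg0 ?w0.
  ring.
rewrite RintegralB //; [|by apply/iB => //; exact: iZ..|by apply/iZ/iB => //; exact: iZ].
rewrite RintegralZl //; last by apply/iB => //; exact: iZ.
rewrite !RintegralB //; [|exact: iZ..].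
by rewrite !RintegralZl // mE subrr mulr0 subr0 subr_ge0.
Qed.

End Chebyshev.

(** * Moments of the Beta weight *)

Section BetaMoments.
Context {R : realType}.
Variables (rho1 rho0 : R).
Hypotheses (rho1_gt0 : 0 < rho1) (rho0_gt0 : 0 < rho0).

Local Notation mu := (@lebesgue_measure R).
Let I01 : set R := `[0, 1]%classic.
Let w (t : R) : R := t `^ (rho1 - 1) * (1 - t) `^ (rho0 - 1).
Let J (a b : nat) : R := \int[mu]_(t in I01) (t ^+ a * (1 - t) ^+ b * w t).

(** Positivity of [r] matters at [x = 0]: for positive [n] the exponent on the left is then nonzero,
    so both sides vanish, away from the convention that 0 to the power 0 is 1. *)
Let powR_natD (r x : R) (n : nat) : 0 < r -> 0 <= x ->
  x `^ (n%:R + r - 1) = x ^+ n * x `^ (r - 1).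
Proof.
move=> r0; elim: n => [|n IHn] x0; first by rewrite add0r expr0 mul1r.
rewrite exprS -mulrA -IHn // mulr_powRB1 //; last by rewrite ltr_wpDl ?ler0n.
by congr powR; rewrite -natr1; ring.
Qed.

Let I01P (t : R) : I01 t -> 0 <= t <= 1.
Proof. by rewrite /I01 /= in_itv. Qed.

Let mI01 : measurable I01.
Proof. exact: measurable_itv. Qed.

Let Beta_natD (a b : nat) : Beta (a%:R + rho1) (b%:R + rho0) = J a b.
Proof.
apply: eq_Rintegral => t; rewrite inE => /I01P /andP[t0 t1].
by rewrite !powR_natD ?subr_ge0 // /w; ring.
Qed.

Let w_ge0 t : 0 <= w t.
Proof. by rewrite mulr_ge0 ?powR_ge0. Qed.

Let onem_mfun : measurable_fun I01 (fun t : R => 1 - t).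
Proof. by apply: measurable_funB. Qed.

Let w_mfun : measurable_fun I01 w.
Proof.
apply: measurable_funM; first by apply: measurable_funTS; exact: measurable_powR.
by apply: (@measurableT_comp _ _ _ _ _ _ (@powR R ^~ (rho0 - 1))).
Qed.

Let J_mfun a b : measurable_fun I01 (fun t => t ^+ a * (1 - t) ^+ b * w t).
Proof.
by apply: measurable_funM => //; apply: measurable_funM; apply: measurable_funX.
Qed.

Let integrand_ge0 (a b : nat) t : I01 t -> 0 <= t ^+ a * (1 - t) ^+ b * w t.
Proof.
move=> /I01P /andP[t0 t1]; apply: mulr_ge0 => //.
by apply: mulr_ge0; rewrite exprn_ge0 ?subr_ge0.
Qed.

Let J00 : J 0 0 = \int[mu]_(t in I01) w t.
Proof. by apply: eq_Rintegral => t _; rewrite !mul1r. Qed.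

Section Integrable.
Hypothesis iw : mu.-integrable I01 (EFin \o w).

Let J_int a b : mu.-integrable I01 (EFin \o (fun t => t ^+ a * (1 - t) ^+ b * w t)).
Proof.
apply: le_integrable iw => //.
  by apply/measurable_EFinP; exact: J_mfun.
move=> t /I01P /andP[t0 t1] /=; rewrite lee_fin normrM ger0_norm.
  rewrite -[leRHS]mul1r ler_wpM2r // mulr_ile1 ?exprn_ge0 ?subr_ge0 //.
    by rewrite exprn_ile1.
  by rewrite exprn_ile1 ?subr_ge0 // lerBlDr lerDl.
by rewrite mulr_ge0 ?exprn_ge0 ?subr_ge0.
Qed.

Let J_le a b : J a b <= J 0 0.
Proof.
apply: le_Rintegral => // t /I01P /andP[t0 t1].
rewrite ler_wpM2r // !expr0 mul1r mulr_ile1 ?exprn_ge0 ?subr_ge0 //.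
  by rewrite exprn_ile1.
by rewrite exprn_ile1 ?subr_ge0 // lerBlDr lerDl.
Qed.

(** A zero integral of a nonnegative function forces it to vanish almost everywhere, but this
    integrand is nonzero on the whole open unit interval, a set of measure 1. *)
Lemma beta_moment_gt0 a b : 0 < J a b.
Proof.
have J0 : 0 <= J a b by apply: Rintegral_ge0 => t; exact: integrand_ge0.
rewrite lt_neqAle J0 andbT eq_sym; apply/eqP => Jab0.
have : (\int[mu]_(t in I01) `|(t ^+ a * (1 - t) ^+ b * w t)%:E| = 0)%E.
  have -> : (0 = (J a b)%:E)%E by rewrite Jab0.
  rewrite /J /Rintegral fineK; last by apply: integrable_fin_num => //; exact: J_int.
  apply: eq_integral => t; rewrite inE => t01.
  by rewrite gee0_abs // lee_fin; exact: integrand_ge0.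
have mJ : measurable_fun I01 (fun t => (t ^+ a * (1 - t) ^+ b * w t)%:E).
  by apply/measurable_EFinP; exact: J_mfun.
move/ae_eq_integral_abs => /(_ mI01 mJ).
move=> [A [mA A0 sA]].
have : (mu (`]0%R, 1%R[%classic : set R) <= 0)%E.
  rewrite -A0; apply: le_measure; rewrite ?inE //.
  apply: subset_trans sA => t /=; rewrite in_itv /= => /andP[t0 t1].
  move=> /(_ (introT andP (conj (ltW t0) (ltW t1)))) [] /eqP.
  rewrite !mulf_eq0 !expf_eq0 !powR_eq0.
  have t1' : 1 - t != 0 by rewrite subr_eq0 gt_eqF.
  by rewrite (gt_eqF t0) (negbTE t1') !andbF.
rewrite lebesgue_measure_itv /= lte_fin ltr01 oppr0 adde0.
by rewrite lee_fin ler10.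
Qed.

(** The sequence [c] stands for either family of pure moments. For [a = 0] any [s] works, since both
    sides are [c 0]. *)
Let J_mean (c : nat -> R) (a : nat) : (forall a, 0 < c a) -> (forall a, c a <= c 0) ->
  exists2 s, 0 <= s <= 1 & s ^+ a * c 0 = c a.
Proof.
move=> c0 cle; case: a => [|a]; first by exists 0; rewrite ?lexx ?ler01 ?mul1r.
have [||s s01 sE] := @expr_root01 R a.+1 (c a.+1 / c 0) => //.
  by apply/andP; split; [apply: divr_ge0; exact: ltW|rewrite ler_pdivrMr ?mul1r].
by exists s; rewrite // sE divfK // gt_eqF.
Qed.

Let J0l a : J a 0 = \int[mu]_(t in I01) (t ^+ a * w t).
Proof. by apply: eq_Rintegral => t _; rewrite mulr1. Qed.

Let J0r b : J 0 b = \int[mu]_(t in I01) ((1 - t) ^+ b * w t).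
Proof. by apply: eq_Rintegral => t _; rewrite mul1r. Qed.

Let J_intl a : mu.-integrable I01 (EFin \o (fun t => t ^+ a * w t)).
Proof. by apply: eq_integrable (J_int a 0) => // t _ /=; rewrite mulr1. Qed.

Let J_intr b : mu.-integrable I01 (EFin \o (fun t => (1 - t) ^+ b * w t)).
Proof. by apply: eq_integrable (J_int 0 b) => // t _ /=; rewrite mul1r. Qed.

(** Chebyshev with two nondecreasing functions: both [t ^+ a] and [t ^+ b] pass their levels
    [s ^+ a] and [s ^+ b] at the same point [s]. *)
Lemma beta_moment_supermul_l a b : J a 0 * J b 0 <= J (a + b) 0 * J 0 0.
Proof.
have [||s /andP[s0 s1] sE] := @J_mean (fun a => J a 0) a => //=.
  by move=> ?; exact: beta_moment_gt0.
rewrite -sE mulrAC ler_pM2r ?beta_moment_gt0 // J0l [leRHS]J0l.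
under [leRHS]eq_Rintegral do rewrite exprD.
apply: (@chebyshev_association _ _ _ mu I01 w _ _ _ (s ^+ b)) => //.
- by apply: eq_integrable (J_intl (a + b)) => // t _ /=; rewrite exprD.
- by move=> t /I01P /andP[t0 _]; exact: expr_comonotone.
- by rewrite -J00 -J0l.
Qed.

(** The mirror image under [t] to [1 - t]; here [s] is a level of [1 - t]. *)
Lemma beta_moment_supermul_r a b : J 0 a * J 0 b <= J 0 (a + b) * J 0 0.
Proof.
have [||s /andP[s0 s1] sE] := @J_mean (fun a => J 0 a) a => //=.
  by move=> ?; exact: beta_moment_gt0.
rewrite -sE mulrAC ler_pM2r ?beta_moment_gt0 // J0r [leRHS]J0r.
under [leRHS]eq_Rintegral do rewrite exprD.
apply: (@chebyshev_association _ _ _ mu I01 w _ _ _ (s ^+ b)) => //.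
- by apply: eq_integrable (J_intr (a + b)) => // t _ /=; rewrite exprD.
- by move=> t /I01P /andP[_ t1]; apply: expr_comonotone; rewrite ?subr_ge0.
- by rewrite -J00 -J0r.
Qed.

(** On [0, 1], [t ^+ a] increases and [(1 - t) ^+ b] decreases, so Chebyshev is applied to [t ^+ a]
    and the negative of [(1 - t) ^+ b], which reverses the inequality. *)
Lemma beta_moment_submul a b : J a b * J 0 0 <= J a 0 * J 0 b.
Proof.
have [||s s01 sE] := @J_mean (fun a => J a 0) a => //=.
  by move=> ?; exact: beta_moment_gt0.
rewrite -sE mulrAC ler_pM2r ?beta_moment_gt0 // J0r -lerN2 -mulrN.
have JN (h : R -> R) : mu.-integrable I01 (EFin \o h) ->
    - (\int[mu]_(t in I01) h t) = \int[mu]_(t in I01) (- h t).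
  move=> ih; rewrite -mulN1r -RintegralZl //.
  by apply: eq_Rintegral => t _; rewrite mulN1r.
rewrite !JN //.
under eq_Rintegral do rewrite -mulNr.
under [leRHS]eq_Rintegral do rewrite -mulNr -mulrN.
apply: (@chebyshev_association _ _ _ mu I01 w _ _ _ (- (1 - s) ^+ b)) => //.
- apply: eq_integrable (integrableN (J_intr b)) => // t _ /=.
  by rewrite mulNr.
- apply: eq_integrable (integrableN (J_int a b)) => // t _ /=.
  by rewrite mulrN mulNr.
- move=> t /I01P t01; rewrite -opprD mulrN oppr_ge0.
  exact: expr_onem_antimonotone.
- by rewrite -J00 -J0l.
Qed.

End Integrable.

(* No integrability of the Beta density is needed: when [w] has an infinite
   integral, [Beta rho1 rho0] is the junk value [0], hence so is [lleaf]. *)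
Let w_int : Beta rho1 rho0 != 0 -> mu.-integrable I01 (EFin \o w).
Proof.
have -> : Beta rho1 rho0 = J 0 0 by rewrite -Beta_natD !add0r.
rewrite J00 => Jn0; apply/integrableP; split.
  by apply/measurable_EFinP; exact: w_mfun.
under eq_integral do rewrite /= ger0_norm //.
rewrite ltey; apply: contra Jn0 => /eqP Joo.
by rewrite /Rintegral Joo.
Qed.

(** If the normalizing constant is 0, division by zero makes every [lleaf] zero. Otherwise [lleaf]
    is a moment divided by [J 0 0], and the moment inequalities are homogeneous. *)
Lemma lleaf_dichotomy :
  (forall a b, lleaf rho1 rho0 a b = 0) \/
  [/\ forall a b, 0 < lleaf rho1 rho0 a b,
      forall a b, lleaf rho1 rho0 a 0 * lleaf rho1 rho0 b 0
                    <= lleaf rho1 rho0 (a + b) 0,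
      forall a b, lleaf rho1 rho0 0 a * lleaf rho1 rho0 0 b
                    <= lleaf rho1 rho0 0 (a + b) &
      forall a b, lleaf rho1 rho0 a b
                    <= lleaf rho1 rho0 a 0 * lleaf rho1 rho0 0 b].
Proof.
have B00 : Beta rho1 rho0 = J 0 0 by rewrite -Beta_natD !add0r.
have [B0|/w_int iw] := eqVneq (Beta rho1 rho0) 0.
  by left=> a b; rewrite /lleaf B0 invr0 mulr0.
have Jgt0 := beta_moment_gt0 iw.
have E a b : lleaf rho1 rho0 a b = J a b / J 0 0.
  by rewrite /lleaf Beta_natD B00.
have scale (x y z : R) : x * y <= z * J 0 0 ->
    x / J 0 0 * (y / J 0 0) <= z / J 0 0.
  move=> h; rewrite mulrACA -invfM ler_pdivrMr ?mulr_gt0 //.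
  by rewrite -mulrA mulKf ?gt_eqF.
right; split=> a b; rewrite !E.
- by rewrite divr_gt0.
- exact/scale/beta_moment_supermul_l.
- exact/scale/beta_moment_supermul_r.
- rewrite mulrACA -invfM ler_pdivlMr ?mulr_gt0 // -mulrA mulKf ?gt_eqF //.
  exact: beta_moment_submul.
Qed.

Lemma ln_lleaf_supadd_l a b :
  ln (lleaf rho1 rho0 a 0) + ln (lleaf rho1 rho0 b 0)
    <= ln (lleaf rho1 rho0 (a + b) 0).
Proof.
(* In the degenerate case [ln 0 = 0] turns the claim into 0 <= 0. *)
case: lleaf_dichotomy => [E|[pos + _ _]]; first by rewrite !E ln0 // addr0.
by rewrite -lnM ?posrE // ler_ln ?posrE //; exact: mulr_gt0.
Qed.

Lemma ln_lleaf_supadd_r a b :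
  ln (lleaf rho1 rho0 0 a) + ln (lleaf rho1 rho0 0 b)
    <= ln (lleaf rho1 rho0 0 (a + b)).
Proof.
case: lleaf_dichotomy => [E|[pos _ + _]]; first by rewrite !E ln0 // addr0.
by rewrite -lnM ?posrE // ler_ln ?posrE //; exact: mulr_gt0.
Qed.

Lemma ln_lleaf_subadd a b :
  ln (lleaf rho1 rho0 a b)
    <= ln (lleaf rho1 rho0 a 0) + ln (lleaf rho1 rho0 0 b).
Proof.
case: lleaf_dichotomy => [E|[pos _ _ +]]; first by rewrite !E ln0 // addr0.
by rewrite -lnM ?posrE // ler_ln ?posrE //; exact: mulr_gt0.
Qed.

End BetaMoments.

(** Equality fails only at [p = 0], where [ln 0 = 0] while [nlog 0] is infinite. This lets lower
    bounds on costs be proved over the reals. *)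
Lemma nlog_ge_ln (R : realType) (p : R) : ((- ln p)%:E <= nlog p)%E.
Proof. by rewrite /nlog; case: ifP => // _; rewrite leey. Qed.

Lemma nlog_ge0 (R : realType) (p : R) : p <= 1 -> (0 <= nlog p)%E.
Proof.
by move=> p1; apply: le_trans (nlog_ge_ln p); rewrite lee_fin oppr_ge0 ln_le0.
Qed.

Lemma connect_sub_preorder (T : finType) (e : rel T) (P : T -> T -> Prop) :
  (forall x, P x x) -> (forall x y z, P x y -> P y z -> P x z) ->
  (forall x y, e x y -> P x y) -> forall x y, connect e x y -> P x y.
Proof.
move=> Prefl Ptrans eP x y /connectP[p + ->]; elim: p x => [|z p IHp] x //=.
by move=> /andP[/eP exz /IHp]; exact: Ptrans.
Qed.

Lemma connect_first_step (T : finType) (e : rel T) (x y : T) :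
  connect e x y = (y == x) || [exists z, e x z && connect e z y].
Proof.
apply/idP/idP.
  case/connectP=> -[|z p] /=; first by move=> _ ->; rewrite eqxx.
  case/andP=> exz zp ->; apply/orP; right; apply/existsP; exists z.
  by rewrite exz; apply/connectP; exists p.
case/orP=> [/eqP->|/existsP[z /andP[exz]]]; first exact: connect0.
exact: connect_trans (connect1 exz).
Qed.

Lemma connect_last_step (T : finType) (e : rel T) (x y : T) :
  connect e x y -> y = x \/ exists2 z, connect e x z & e z y.
Proof.
case/connectP=> p; case/lastP: p => [|p z]; first by move=> _ ->; left.
rewrite rcons_path last_rcons => /andP[xp ez] ->; right.
by exists (last x p) => //; apply/connectP; exists p.
Qed.

(** * The AND/OR graph *)

Section Graph.
Variables (N F : nat) (X : 'I_N -> 'I_F -> bool).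
Implicit Types (u v a c : node N F) (S : {set node N F}) (k : bool).

Definition label u : {set 'I_N} :=
  match u with
  | inl (inl (s, _)) => s
  | inl (inr (s, _)) => s
  | inr (s, _, _) => s
  end.

(** Doubling the depth leaves an odd level for the terminal and AND nodes between OR nodes of
    consecutive depths, so every edge strictly increases [rank] and the graph is acyclic. *)
Definition rank u : nat := (depth u).*2 + ~~ isOR u.

Lemma restr_cover (I : {set 'I_N}) (f : 'I_F) :
  restr X I f false :|: restr X I f true = I.
Proof.
by apply/setP => i; rewrite !inE -andb_orr orbC; case: (X i f); rewrite andbT.
Qed.

Lemma restr_disjoint (I : {set 'I_N}) (f : 'I_F) :
  restr X I f false :&: restr X I f true = finset.set0.
Proof. by apply/setP => i; rewrite !inE; case: (X i f); rewrite !andbF. Qed.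

Lemma restr_sub (I : {set 'I_N}) (f : 'I_F) k : restr X I f k \subset I.
Proof. by apply/fintype.subsetP => i; rewrite inE => /andP[]. Qed.

Lemma cnt_restr (Y : 'I_N -> bool) k (I : {set 'I_N}) (f : 'I_F) :
  cnt Y k I = (cnt Y k (restr X I f false) + cnt Y k (restr X I f true))%N.
Proof.
rewrite /cnt -[in LHS](restr_cover I f) -cardsUI.
set A := [set i in restr X I f false | _]; set B := [set i in restr X I f true | _].
have -> : A :&: B = finset.set0.
  by apply/setP => i; rewrite !inE; case: (X i f); rewrite !andbF.
rewrite cards0 addn0; apply: eq_card => i.
by rewrite !inE; case: (i \in I); case: (X i f); rewrite /= ?orbF.
Qed.

Lemma isOR_kid k a : isAND a -> isOR (kid X k a).
Proof. by case: a => [[[I d]|[I d]]|[[I d] f]]. Qed.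

Lemma edge_rank u v : edge X u v -> (rank u < rank v)%N.
Proof.
case: u v => [[[I d]|[I d]]|[[I d] f]] [[[I' d']|[I' d']]|[[I' d'] f']] //=.
- by case/and3P=> _ _ /eqP->; rewrite /rank /= addn0 addn1.
- by case/and5P=> _ _ /eqP-> _ _; rewrite /rank /= addn0 addn1.
- by case/and5P=> _ _ _ /eqP; rewrite /rank /= => -> _; rewrite doubleS addn0 addn1.
Qed.

Lemma edge_label u v : edge X u v -> label v \subset label u.
Proof.
case: u v => [[[I d]|[I d]]|[[I d] f]] [[[I' d']|[I' d']]|[[I' d'] f']] //=.
- by case/and3P=> _ /eqP->.
- by case/and5P=> _ /eqP->.
- by case/and5P=> _ _ _ _ /orP[]/eqP->; exact: restr_sub.
Qed.

(** Below an AND node this is the condition that [f] lies in [Vset]. With the disjointness of the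
    two restrictions it keeps the branches apart. *)
Lemma edge_label_neq0 u v : edge X u v -> label v != finset.set0.
Proof.
case: u v => [[[I d]|[I d]]|[[I d] f]] [[[I' d']|[I' d']]|[[I' d'] f']] //=.
- by case/and3P=> I0 /eqP->.
- by case/and5P=> I0 /eqP->.
- by case/and5P=> _ _; rewrite inE => /andP[I0 I1] _ /orP[]/eqP->.
Qed.

(** A terminal or AND node records the index set and depth of its parent, so only OR nodes can be
    shared. *)
Lemma edge_OR_inj u u' v : isOR u -> edge X u v -> edge X u' v -> u = u'.
Proof.
case: u v u' => [[[I d]|[I d]]|[[I d] f]] [[[I' d']|[I' d']]|[[I' d'] f']] //=;
  case=> [[[J e]|[J e]]|[[J e] g]] //= _.
- by case/and3P=> _ /eqP-> /eqP-> /and3P[_ /eqP-> /eqP->].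
- by case/and5P=> _ /eqP-> /eqP-> _ _ /and5P[_ /eqP-> /eqP->].
Qed.

Lemma edge_OR_child u v : isOR u -> edge X u v -> v = term u \/ isAND v.
Proof.
case: u v => [[[I d]|[I d]]|[[I d] f]] [[[I' d']|[I' d']]|[[I' d'] f']] //= _.
- by case/and3P=> _ /eqP-> /eqP->; left.
- by right.
Qed.

Lemma edge_term u : isOR u -> label u != finset.set0 -> edge X u (term u).
Proof. by case: u => [[[I d]|[I d]]|[[I d] f]] //= _ ->; rewrite !eqxx. Qed.

(** The edge into [a] supplies [d < F], so that [inord] in [kid] returns the true successor and not
    its default. *)
Lemma edge_kid k u a : isAND a -> edge X u a -> edge X a (kid X k a).
Proof.
case: u a => [[[I d]|[I d]]|[[I d] f]] [[[I' d']|[I' d']]|[[I' d'] f']] //= _.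
case/and5P=> I0 /eqP-> /eqP-> dF fV; rewrite I0 dF fV /= inordK // eqxx.
by case: k; rewrite eqxx ?orbT.
Qed.

Lemma edge_ANDP a v : isAND a -> edge X a v -> v = kid X false a \/ v = kid X true a.
Proof.
case: a v => [[[I d]|[I d]]|[[I d] f]] [[[I' d']|[I' d']]|[[I' d'] f']] //= _.
case/and5P=> _ _ _ /eqP d'E; have -> : d' = inord d.+1.
  by apply: val_inj; rewrite /= -d'E inordK.
by case/orP=> /eqP->; [left|right].
Qed.

Lemma depth_kid k u a : isAND a -> edge X u a ->
  depth (kid X k a) = (depth u).+1 /\ (depth u < F)%N.
Proof.
case: u a => [[[I d]|[I d]]|[[I d] f]] [[[I' d']|[I' d']]|[[I' d'] f']] //= _.
by case/and5P=> _ _ /eqP-> dF _; rewrite inordK.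
Qed.

Lemma label_kid_disjoint a : isAND a ->
  label (kid X false a) :&: label (kid X true a) = finset.set0.
Proof. by case: a => [[[I d]|[I d]]|[[I d] f]] //= _; exact: restr_disjoint. Qed.

(** * Costs of solution graphs *)

Section SolutionCost.
Context {R : realType}.
Variables (Y : 'I_N -> bool) (rho1 rho0 alpha beta : R).
Local Notation cost := (cost X Y rho1 rho0 alpha beta).
Local Notation groot := (groot N F).

Variable S : {set node N F}.
Hypothesis solS : solution_graph X S.

Let eS : rel (node N F) := [rel x y | [&& x \in S, y \in S & edge X x y]].

(** Each reachable node is counted once, however many paths lead to it; additivity at AND nodes
    therefore needs an argument. *)
Definition subcost u : \bar R :=
  (\sum_(x | connect eS u x) \sum_(y in S | edge X x y) cost x y)%E.

Let inS_inG u : u \in S -> inG X u.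
Proof. by case: solS => _ + _ _ _; exact. Qed.

Let inS_edge u v : u \in S -> edge X u v -> inG X v.
Proof.
by move=> /inS_inG uG uv; apply: connect_trans uG _; exact: connect1.
Qed.

Lemma sgcost_subcost : sgcost X Y rho1 rho0 alpha beta S = subcost groot.
Proof.
case: solS => rS _ conn _ _; apply: eq_bigl => x; apply/idP/idP; first exact: conn.
move=> /connect_last_step[->//|[z _ /and3P[]//]].
Qed.

Let connect_rank u v : connect eS u v -> (rank u <= rank v)%N.
Proof.
apply: (@connect_sub_preorder _ _ (fun x y => rank x <= rank y)%N) => //.
  by move=> x y z; exact: leq_trans.
by move=> x y /and3P[_ _ /edge_rank/ltnW].
Qed.

Let connect_label u v : connect eS u v -> label v \subset label u.
Proof.
apply: (@connect_sub_preorder _ _ (fun x y => label y \subset label x)) => //.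
  by move=> x y z xy yz; exact: fintype.subset_trans yz xy.
by move=> x y /and3P[_ _ /edge_label].
Qed.

Let connect_label_neq0 u v :
  label u != finset.set0 -> connect eS u v -> label v != finset.set0.
Proof.
by move=> u0 /connect_last_step[->//|[z _ /and3P[_ _ /edge_label_neq0]]].
Qed.

Let connect_cycle u c : edge X u c -> connect eS c u = false.
Proof.
move=> /edge_rank uc; apply/negP => /connect_rank.
by rewrite leqNgt uc.
Qed.

Lemma solution_child u : u \in S -> isOR u -> exists c,
  [/\ c \in S, edge X u c & forall v, v \in S -> edge X u v -> v = c].
Proof.
case: solS => _ _ _ _ uniqS uS uO; have /eqP/cards1P[c cE] := uniqS u uS uO.
have := set11 c; rewrite -cE !inE => /and3P[cS _ uc]; exists c; split=> // v vS uv.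
by apply/set1P; rewrite -cE !inE vS uv (inS_edge uS uv).
Qed.

Lemma solution_kid k u a :
  a \in S -> isAND a -> edge X u a -> kid X k a \in S.
Proof.
case: solS => _ _ _ andS _ aS aA ua; have ak := edge_kid k aA ua.
by apply: (andS a aS aA) => //; exact: inS_edge aS ak.
Qed.

(** The nodes reachable from [u] are [u] and those reachable from [c]; acyclicity keeps [u] out of
    the latter. *)
Lemma subcost_OR u c : u \in S -> c \in S -> edge X u c ->
  (forall v, v \in S -> edge X u v -> v = c) ->
  subcost u = (cost u c + subcost c)%E.
Proof.
move=> uS cS uc cuniq; rewrite /subcost (bigD1 u) ?connect0 //=; congr adde.
  rewrite (big_pred1 c) // => v /=; apply/andP/eqP => [[]|->//]; exact: cuniq.
apply: eq_bigl => x; rewrite connect_first_step.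
have [->|_] /= := eqVneq x u; first by rewrite connect_cycle.
rewrite andbT; apply/existsP/idP => [[z /andP[/and3P[_ zS uz]]]|cx].
  by rewrite (cuniq z).
by exists c; rewrite cx /eS /= uS cS uc.
Qed.

Lemma subcost_term u : isOR u -> subcost (term u) = 0%E.
Proof.
case: u => [[[I d]|[I d]]|[[I d] f]] //= _; rewrite /subcost big1 // => x.
rewrite connect_first_step => /orP[/eqP->|/existsP[z /andP[/and3P[_ _]]]] //.
by rewrite big1 // => y /andP[].
Qed.

(* The two branches share no node because their labels are disjoint. *)
Lemma subcost_AND u a : a \in S -> isAND a -> edge X u a ->
  subcost a = (subcost (kid X false a) + subcost (kid X true a))%E.
Proof.
move=> aS aA ua.
have kS k := solution_kid k aS aA ua.
have ak k := edge_kid k aA ua.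
rewrite /subcost (bigD1 a) ?connect0 //= big1 ?add0e; last first.
  by move=> v _; case: (a) aA => [[[I d]|[I d]]|[[I d] f]].
(* AND edges are free, so only the nodes strictly below [a] remain. They are split by whether the
   value-0 child reaches them. *)
rewrite (bigID (connect eS (kid X false a))) /=.
congr adde; apply: eq_bigl => x; rewrite connect_first_step.
- have [->|_] /= := eqVneq x a; first by rewrite !connect_cycle.
  rewrite andbT; apply: andb_idl => k0x; apply/existsP; exists (kid X false a).
  by rewrite k0x /eS /= aS kS ak.
- have [->|_] /= := eqVneq x a; first by rewrite !connect_cycle.
  rewrite andbT; apply/andP/idP => [[/existsP[z /andP[/and3P[_ _ az] zx]]]|k1x].
    by case: (edge_ANDP aA az) zx => -> // ->.
  split; first by apply/existsP; exists (kid X true a); rewrite k1x /eS /= aS kS ak.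
  apply/negP => k0x.
  have /negP[] := connect_label_neq0 (edge_label_neq0 (ak true)) k1x.
  by rewrite -finset.subset0 -(label_kid_disjoint aA) finset.subsetI !connect_label.
Qed.

End SolutionCost.
End Graph.

(** * Correctness of the search *)

Section Search.
Context {R : realType}.
Variables (N F : nat) (X : 'I_N -> 'I_F -> bool) (Y : 'I_N -> bool).
Variables (rho1 rho0 alpha beta : R).
Hypotheses (rho1_gt0 : 0 < rho1) (rho0_gt0 : 0 < rho0).
Hypotheses (alpha_gt0 : 0 < alpha) (alpha_lt1 : alpha < 1) (beta_ge0 : 0 <= beta).
Hypothesis N_gt0 : (0 < N)%N.
Implicit Types (u v a c : node N F) (G Q : {set node N F}) (B : node N F -> \bar R).

Local Notation edge := (edge X).
Local Notation cost := (cost X Y rho1 rho0 alpha beta).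
Local Notation psplit := (psplit alpha beta).
Local Notation lleaf := (lleaf rho1 rho0).
Local Notation hval := (hval Y rho1 rho0 alpha beta).
Local Notation hnode := (hnode Y rho1 rho0 alpha beta).
Local Notation minA := (Defs.minA X Y rho1 rho0 alpha beta).
Local Notation newval := (newval X Y rho1 rho0 alpha beta).
Local Notation propagate := (propagate X Y rho1 rho0 alpha beta).
Local Notation expand := (Defs.expand X Y rho1 rho0 alpha beta).
Local Notation subcost := (subcost X Y rho1 rho0 alpha beta).
Local Notation groot := (groot N F).

(** * Consistency of the heuristic *)

Lemma psplit_gt0 d : 0 < psplit d.
Proof. by rewrite mulr_gt0 // powR_gt0 // ltr_pwDl. Qed.

Lemma psplit_le1 d : psplit d <= 1.
Proof.
rewrite -[leRHS]mulr1; apply: ler_pM; rewrite ?powR_ge0 ?(ltW alpha_gt0) ?(ltW alpha_lt1) //.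
have base_ge1 : 1 <= 1 + d%:R :> R by rewrite lerDl.
have betaN_le0 : - beta <= 0 by rewrite oppr_le0.
by apply: le_trans (ler_powR base_ge1 betaN_le0) _; rewrite powRr0.
Qed.

Lemma hval_le_leaf (I : {set 'I_N}) (d e : nat) :
  (hval I d <= nlog (pleaf X alpha beta e I) +
               nlog (lleaf (cnt Y true I) (cnt Y false I)))%E.
Proof.
rewrite -[leLHS]add0e leeD //.
  apply: nlog_ge0; rewrite /pleaf; case: ifP => // _.
  by rewrite gerBl ltW // psplit_gt0.
apply: le_trans (nlog_ge_ln _).
by rewrite lee_fin lerN2 le_max lexx.
Qed.

(** The parent's maximum is at least its split entry. Each child's maximum is at most the sum of its
    two one-class terms: by subadditivity for the leaf entry, by [psplit <= 1] for the split entry.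
    Superadditivity then merges the one-class terms of the children into those of the parent. *)
Lemma hval_le_split (I : {set 'I_N}) (f : 'I_F) (d e : nat) : f \in Vset X I ->
  (hval I d <= nlog (pinner X alpha beta d I) +
    (hval (restr X I f false) e + hval (restr X I f true) e))%E.
Proof.
(* [M], [M0], [M1] are the maxima at the parent and the children, [p] and [q] the logarithms of the
   split and inner probabilities, the [a]'s and [b]'s the one-class terms for labels 1 and 0. *)
have lin (M M0 M1 p q a0 b0 a1 b1 a b : R) : M0 <= a0 + b0 -> M1 <= a1 + b1 ->
    p + a + b <= M -> a0 + a1 <= a -> b0 + b1 <= b -> q <= p ->
    - M <= - q + (- M0 + - M1).
  by move=> *; lra.
move=> fV; have V0 : Vset X I != finset.set0 by apply/set0Pn; exists f.
have cV : (0 < #|Vset X I|)%N by rewrite card_gt0.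
apply: le_trans (leeD2r _ (nlog_ge_ln _)).
rewrite /pinner (negbTE V0).
pose lt (J : {set 'I_N}) := ln (lleaf (cnt Y true J) 0).
pose lf (J : {set 'I_N}) := ln (lleaf 0 (cnt Y false J)).
pose m (J : {set 'I_N}) (k : nat) :=
  Num.max (ln (lleaf (cnt Y true J) (cnt Y false J))) (ln (psplit k) + lt J + lf J).
change ((- m I d)%:E <= (- ln (psplit d / #|Vset X I|%:R))%:E +
  ((- m (restr X I f false) e)%:E + (- m (restr X I f true) e)%:E))%E.
rewrite -!EFinD lee_fin.
have child_le J : m J e <= lt J + lf J.
  rewrite ge_max ln_lleaf_subadd //= -addrA gerDr ln_le0 //.
  exact: psplit_le1.
have m0_le := child_le (restr X I f false).
have m1_le := child_le (restr X I f true).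
have m_ge : ln (psplit d) + lt I + lf I <= m I d by rewrite le_max lexx orbT.
have super_l := ln_lleaf_supadd_l rho1_gt0 rho0_gt0
  (cnt Y true (restr X I f false)) (cnt Y true (restr X I f true)).
have super_r := ln_lleaf_supadd_r rho1_gt0 rho0_gt0
  (cnt Y false (restr X I f false)) (cnt Y false (restr X I f true)).
rewrite -!cnt_restr in super_l super_r.
have pinner_le : ln (psplit d / #|Vset X I|%:R) <= ln (psplit d).
  rewrite ler_ln ?posrE ?divr_gt0 ?psplit_gt0 ?ltr0n //.
  by rewrite ler_pdivrMr ?ltr0n // ler_peMr ?ler1n // ltW // psplit_gt0.
exact: lin m0_le m1_le m_ge super_l super_r pinner_le.
Qed.

(** A minimum over more candidates with smaller values is smaller. Bounds are read only at children
    of AND nodes, so comparing them on OR nodes suffices. *)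
Lemma le_newval G1 G2 B1 B2 u : andkids X G2 u \subset andkids X G1 u ->
  (forall v, isOR v -> (B1 v <= B2 v)%E) -> (newval G1 B1 u <= newval G2 B2 u)%E.
Proof.
move=> /fintype.subsetP sub le12; rewrite /Defs.newval le_min2 // /Defs.minA.
apply/bigmin_geP; split=> [|a a2]; first exact: leey.
apply: (bigmin_inf a); first exact: sub.
have aA : isAND a by move: a2; rewrite inE => /and3P[].
by rewrite leeD2l // leeD // le12 // isOR_kid.
Qed.

(* Least cost of a derivation tree below a node of height at most [n]. *)
Definition opt (n : nat) : node N F -> \bar R :=
  iter n (newval [set: node N F]) (fun=> +oo%E).

Lemma hnode_le_opt n u : isOR u -> (hnode u <= opt n u)%E.
Proof.
elim: n u => [|n IHn] u uO; first exact: leey.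
(* Consistency makes [hnode] a subsolution of the Bellman recursion; monotonicity then carries it
   below every iterate. *)
suff h_cons : (hnode u <= newval [set: node N F] hnode u)%E.
  by apply: le_trans h_cons _; exact: le_newval.
rewrite le_min; apply/andP; split; last first.
  by case: u uO => [[[I d]|[I d]]|[[I d] f]] //= _; exact: hval_le_leaf.
apply/bigmin_geP; split=> [|a]; first exact: leey.
rewrite !inE /=; case: u a uO => [[[I d]|[I d]]|[[I d] f]]
  [[[I' d']|[I' d']]|[[I' d'] f']] //= _.
case/and5P=> _ /eqP-> /eqP-> dF fV; rewrite /valA /= inordK //.
exact: hval_le_split.
Qed.

(** Each AND step raises the depth by one and depth is at most [F], so the bound on [n] guarantees
    enough iterations for the part of [S] below [u]. *)
Lemma opt_le_subcost S n u : solution_graph X S -> u \in S -> isOR u ->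
  (F - depth u < n)%N -> (opt n u <= subcost S u)%E.
Proof.
move=> solS; elim: n u => // n IHn u uS uO dn.
have [c [cS uc cuniq]] := solution_child solS uS uO.
rewrite (subcost_OR _ _ _ _ _ uS cS uc cuniq) [leLHS]/= ge_min.
have [cT|cA] := edge_OR_child uO uc.
  by rewrite cT subcost_term // adde0 lexx orbT.
apply/orP; left; apply: (bigmin_inf c); first by rewrite !inE cA.
rewrite (subcost_AND _ _ _ _ _ solS cS cA uc) leeD2l //.
have kS k := solution_kid solS k cS cA uc.
have le_kid k : (opt n (kid X k c) <= subcost S (kid X k c))%E.
  have [dk dF] := depth_kid k cA uc.
  by apply: IHn; rewrite ?isOR_kid // dk subnSK.
by rewrite leeD.
Qed.

(** * Invariants of the search *)

Definition kids_closed G := forall u a a', isAND a -> isAND a' ->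
  edge u a -> edge u a' -> a \in G -> a' \in G.

(** Expansion adds all AND children of a node at once, so one of them in [G] certifies that [newval]
    at [u] minimizes over the complete set. *)
Lemma andkids_closed G u a : kids_closed G -> isAND a -> edge u a -> a \in G ->
  andkids X [set: node N F] u \subset andkids X G u.
Proof.
move=> clG aA ua aG; apply/fintype.subsetP => a'; rewrite !inE /= => /andP[a'A ua'].
by rewrite a'A ua' !andbT; exact: clG _ _ _ aA a'A ua ua' aG.
Qed.

Lemma descend_OR st u o : isOR u ->
  descend X Y rho1 rho0 alpha beta st u o -> isOR o.
Proof.
move=> uO ds; elim: ds uO => // {}o a o'' _ + _ _ IH _.
by rewrite inE => /and3P[_ aA _]; apply: IH; case: ifP; rewrite isOR_kid.
Qed.

Lemma expand_and st o a : isOR o -> isAND a ->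
  (a \in Gp (expand st o)) = (a \in Gp st) || edge o a.
Proof.
move=> oO aA; have orF k : a \in [set kid X k b | b in [set b | isAND b && edge o b]] = false.
  apply/negbTE/imsetP => -[b]; rewrite inE => /andP[bA _] abE.
  by move: (isOR_kid X k bA); rewrite -abE; case: (a) aA => [[[I d]|[I d]]|[[I d] f]].
rewrite /= !finset.in_setU !orF !orbF finset.in_set1 inE aA /=.
by case: o a oO aA {orF} => [[[I d]|[I d]]|[[I d] f]] [[[I' d']|[I' d']]|[[I' d'] f']]
  //=; rewrite orbF.
Qed.

(** Queued nodes must have all their AND children in [G]: a minimum over only some of them could
    exceed [opt]. A newly queued parent has one such child in [G], hence all by closure. *)
Lemma propagate_lb n G Q B B' : kids_closed G ->
  (forall u, u \in Q -> isOR u /\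
     andkids X [set: node N F] u \subset andkids X G u) ->
  (forall n u, isOR u -> (B u <= opt n u)%E) ->
  propagate G lb_better Q B B' -> forall u, isOR u -> (B' u <= opt n u)%E.
Proof.
move=> clG + + pr; elim: pr => [{}B|{}Q {}B {}B' u uQ _ _ IH] QP BP; first exact: BP.
apply: IH.
  have QuP v : v \in Q :\ u -> isOR v /\
      andkids X [set: node N F] v \subset andkids X G v.
    by rewrite !inE => /andP[_ /QP].
  case: ifP => _ // v; rewrite finset.in_setU => /orP[/QuP //|].
  rewrite inE => /and3P[_ vO /existsP[a /andP[aG /andP[/andP[aA va] _]]]].
  by split=> //; exact: andkids_closed aA va aG.
case: ifP => _ // m v vO; rewrite /upd; case: eqP => [->|_]; last exact: BP.
(* The bound is kept for all heights together because height [m.+1] at [u] uses height [m] at its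
   children. *)
case: m => [|m]; first exact: leey.
by apply: le_newval => [|w]; [case: (QP _ uQ)|exact: BP].
Qed.

(** Lowering one value can only lower [newval] everywhere, and at the updated node the new value is
    the old [newval]. The order of the queue does not matter. *)
Lemma propagate_ub G Q B B' : (forall u, newval G B u <= B u)%E ->
  propagate G ub_better Q B B' -> (forall u, newval G B' u <= B' u)%E.
Proof.
move=> + pr; elim: pr => // {}Q {}B {}B' u uQ _ _ IH BP; apply: IH.
case: ifP => // lt_u w; set B1 := upd _ _ _.
have B1_le v : (B1 v <= B v)%E by rewrite /B1 /upd; case: eqP => // ->; exact: ltW.
have : (newval G B1 w <= newval G B w)%E by exact: le_newval.
by rewrite [in X in _ -> X]/B1 /upd; case: eqP => [->//|_ /le_trans]; apply.
Qed.

Record search_invariant (st : @Defs.state R N F) : Prop := SearchInvariant {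
  inv_closed : kids_closed (Gp st);
  inv_lb : forall n u, isOR u -> (LB st u <= opt n u)%E;
  inv_ub : forall u, (newval (Gp st) (UB st) u <= UB st u)%E }.

Lemma reachable_invariant st :
  reachable_state X Y rho1 rho0 alpha beta st -> search_invariant st.
Proof.
elim=> [|{}st st' _ [clG lb ub] [p LB' UB' _ ds prL prU ->]].
  split=> [u a a' aA _ _ _|n u|u]; last exact: leey.
    by rewrite inE => /eqP aE; rewrite aE in aA.
  exact: hnode_le_opt.
have pO : isOR p by exact: descend_OR ds.
have clG' : kids_closed (Gp (expand st p)).
  move=> u a a' aA a'A ua ua'; rewrite !expand_and // => /orP[aG|pa].
    by rewrite (clG u a a').
  by rewrite (edge_OR_inj pO pa ua) ua' orbT.
split=> //=.
- move=> n; apply: propagate_lb prL => //.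
    move=> u /set1P ->; split=> //; apply/fintype.subsetP => a.
    rewrite inE => /and3P[_ aA pa].
    by rewrite inE (expand_and st pO aA) aA pa orbT.
  (* A reset may lower an [LB] raised earlier, but the reset value is itself below [opt]. *)
  move=> m u uO /=; case: ifP => _; [exact: hnode_le_opt|exact: lb].
- apply: propagate_ub prU => u; apply: le_trans (ub u).
  apply: le_newval => //; apply/fintype.subsetP => a.
  by rewrite !inE => /and3P[-> -> ->].
Qed.

(** * The extracted solution graph *)

Section GetSolution.
Variables (st : @Defs.state R N F) (ch : node N F -> node N F).
Hypothesis chP : valid_choice X Y rho1 rho0 alpha beta st ch.

Local Notation sol := (getSolution X Y rho1 rho0 alpha beta st ch).
Local Notation step := (solrel X Y rho1 rho0 alpha beta st ch).
Local Notation dec := (decision X Y rho1 rho0 alpha beta st ch).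

Let step_edge u v : label u != finset.set0 -> step u v -> edge u v.
Proof.
rewrite /solrel; case: ifP => [uO u0 /eqP->|_ _ /andP[]//].
rewrite /decision; case: ifP => [_|/norP[/chP[+ _] _]]; first exact: edge_term.
by rewrite inE => /and3P[].
Qed.

(** The edge to a terminal requires a nonempty index set; [N > 0] gives this at the root and every
    step preserves it. *)
Let sol_label u : u \in sol -> label u != finset.set0.
Proof.
rewrite inE => ru.
apply: (@connect_sub_preorder _ step
  (fun x y => label x != finset.set0 -> label y != finset.set0) _ _ _ groot u) => //.
- by move=> x y z xy yz /xy/yz.
- by move=> x y xy x0; exact: edge_label_neq0 (step_edge x0 xy).
- by apply/set0Pn; exists (Ordinal N_gt0); rewrite inE.
Qed.

Let sol_step u v : u \in sol -> step u v -> v \in sol /\ edge u v.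
Proof.
move=> uS uv; split; last exact: step_edge (sol_label uS) uv.
by move: uS; rewrite !inE => /connect_trans; apply; exact: connect1.
Qed.

Let sol_root : groot \in sol.
Proof. by rewrite inE connect0. Qed.

Lemma getSolution_solution_graph : solution_graph X sol.
Proof.
have conn u : u \in sol ->
    connect [rel x y | [&& x \in sol, y \in sol & edge x y]] groot u.
  rewrite {1}inE => /connectP[p + ->]; elim: p groot sol_root => [|v p IHp] u0 u0S /=.
    by rewrite connect0.
  case/andP=> /(sol_step u0S)[vS u0v] /(IHp _ vS).
  by apply: connect_trans; apply: connect1; rewrite /= u0S vS.
have inGsol u : u \in sol -> inG X u.
  by move=> /conn; apply: connect_sub => x y /and3P[_ _ /connect1].
split=> //.
- move=> a aS aA v _ av; apply: (proj1 (sol_step aS _)).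
  by rewrite /solrel aA av; case: (a) aA => [[[I d]|[I d]]|[[I d] f]].
- move=> u uS uO; apply/eqP/cards1P; exists (dec u).
  have stepu : step u (dec u) by rewrite /solrel uO.
  have [dS ud] := sol_step uS stepu.
  apply/setP => v; rewrite !inE; apply/idP/eqP => [/and3P[rv _ uv]|->]; last first.
    by move: dS; rewrite inE => rd; rewrite rd ud -/(inG X _) inGsol // inE.
  (* A child [v] of [u] is not the root, which has rank 0, so some [w] steps to it. Uniqueness of
     the parent gives [w = u], hence [v] is the decision at [u]. *)
  case/connect_last_step: rv => [vr|[w rw wv]].
    by move: (edge_rank uv); rewrite vr.
  have wS : w \in sol by rewrite inE.
  have [_ /(edge_OR_inj uO uv) uw] := sol_step wS wv.
  by move: wv; rewrite /solrel -uw uO => /eqP.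
Qed.

(** [UB u] dominates [newval], and the decision at [u] attains that minimum; induction bounds the
    subgraphs below the chosen AND node by the [UB] of its children. *)
Lemma subcost_getSolution n u :
  (forall v, newval (Gp st) (UB st) v <= UB st v)%E ->
  u \in sol -> isOR u -> (F - depth u < n)%N -> (subcost sol u <= UB st u)%E.
Proof.
move=> ub; have solS := getSolution_solution_graph.
elim: n u => // n IHn u uS uO dn; apply: le_trans (ub u).
have [c [cS uc cuniq]] := solution_child solS uS uO.
have [dS ud] : dec u \in sol /\ edge u (dec u).
  by apply: sol_step => //; rewrite /solrel uO.
have dE := cuniq _ dS ud.
rewrite (subcost_OR _ _ _ _ _ uS cS uc cuniq) /Defs.newval.
move: dE; rewrite /decision; case: ifP => [tle <-|/norP[kn0 tgt] <-].
  rewrite subcost_term // adde0 le_min lexx andbT.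
  (* Without AND children, [minA] is an empty minimum, hence infinite. *)
  case/orP: tle => // /eqP kids0; rewrite /Defs.minA kids0 big_set0; exact: leey.
have [chk chE] := chP kn0; move: chk; rewrite inE => /and3P[_ chA uch].
have chS : ch u \in sol.
  by move: dS; rewrite /decision (negbTE kn0) (negbTE tgt).
move: (tgt); rewrite -ltNge => /ltW/min_idPl->.
rewrite -chE (subcost_AND _ _ _ _ _ solS chS chA uch) leeD2l //.
have kS k := solution_kid solS k chS chA uch.
have le_kid k : (subcost sol (kid X k (ch u)) <= UB st (kid X k (ch u)))%E.
  have [dk dF] := depth_kid k chA uch.
  by apply: IHn; rewrite ?isOR_kid // dk subnSK.
by rewrite leeD.
Qed.

End GetSolution.
End Search.

Theorem theorem10 (R : realType) (N F : nat)
    (X : 'I_N -> 'I_F -> bool) (Y : 'I_N -> bool)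
    (rho1 rho0 alpha beta : R) :
  0 < rho1 -> 0 < rho0 -> 0 < alpha -> alpha < 1 -> 0 <= beta ->
  (0 < N)%N ->
  forall st : @Defs.state R N F,
    reachable_state X Y rho1 rho0 alpha beta st ->
    ~ (LB st (groot N F) < UB st (groot N F))%E ->
    forall ch : node N F -> node N F,
      valid_choice X Y rho1 rho0 alpha beta st ch ->
      solution_graph X (getSolution X Y rho1 rho0 alpha beta st ch) /\
      (forall S : {set node N F}, solution_graph X S ->
         (sgcost X Y rho1 rho0 alpha beta (getSolution X Y rho1 rho0 alpha beta st ch)
          <= sgcost X Y rho1 rho0 alpha beta S)%E).
Proof.
move=> rho1_gt0 rho0_gt0 alpha_gt0 alpha_lt1 beta_ge0 N_gt0 st reach stop ch chP.
have [_ lb ub] := reachable_invariant rho1_gt0 rho0_gt0 alpha_gt0 alpha_lt1 beta_ge0 reach.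
have solG := getSolution_solution_graph N_gt0 chP.
split=> // S solS; rewrite !sgcost_subcost //.
have rootIn T : solution_graph X T -> groot N F \in T by case.
apply: (@le_trans _ _ (UB st (groot N F))).
  (* Depths 0 to [F] give [F.+1] levels of OR nodes, hence the height [F.+1] at the root. *)
  by apply: (@subcost_getSolution _ _ _ _ _ _ _ _ _ N_gt0 _ _ chP F.+1) => //;
    [exact: rootIn|rewrite subn0].
apply: (@le_trans _ _ (LB st (groot N F))); first by rewrite leNgt; apply/negP.
apply: le_trans (lb F.+1 (groot N F) isT) _.
by apply: opt_le_subcost => //; [exact: rootIn|rewrite subn0].
Qed.
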